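(* Let $L\ge 0$ be an integer, let $\hat{\mathbf r}\in S^2$, and let $\mathbf R\in SO(3)$ be any rotation with $\mathbf R\,\hat{\mathbf r}=(0,1,0)$. Let $\mathbf x^{(l)}\in\mathbb R^{2l+1}$ for $0\le l\le L$, and let $\mathbf h_{l_i,l_f,l_o}\in\mathbb R$ be arbitrary scalars for $0\le l_i,l_o\le L$ and $|l_i-l_o|\le l_f\le l_i+l_o$. For $0\le l_o\le L$ define the equivariant convolution $$\mathbf a^{(l_o)}=\sum_{l_i=0}^{L}\ \sum_{l_f=|l_i-l_o|}^{l_i+l_o}\mathbf x^{(l_i)}\otimes^{l_o}_{l_i,l_f}\bigl(\mathbf h_{l_i,l_f,l_o}\,\mathbf Y^{(l_f)}(\hat{\mathbf r})\bigr)\in\mathbb R^{2l_o+1}.$$ Put $\tilde{\mathbf x}^{(l)}=\mathbf D^{(l)}(\mathbf R)\,\mathbf x^{(l)}$ and, for $|m|\le\min(l_i,l_o)$, $$\tilde{\mathbf h}^{(l_i,l_o)}_m=\sum_{l_f=|l_i-l_o|}^{l_i+l_o}\mathbf h_{l_i,l_f,l_o}\,(\mathbf c_{l_i,l_f,l_o})_m,\qquad (\mathbf c_{l_i,l_f,l_o})_m=\begin{cases}\mathbf C^{(l_o,m)}_{(l_i,m),(l_f,0)} & m\ge 0,\\ \mathbf C^{(l_o,m)}_{(l_i,-m),(l_f,0)} & m<0.\end{cases}$$ Then for every $0\le l_o\le L$ $$\mathbf a^{(l_o)}=\mathbf D^{(l_o)}(\mathbf R^{-1})\sum_{l_i=0}^{L}\mathbf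 w^{(l_o)}_{l_i},$$ where $\mathbf w^{(l_o)}_{l_i}\in\mathbb R^{2l_o+1}$ is given by $(\mathbf w^{(l_o)}_{l_i})_0=\tilde{\mathbf h}^{(l_i,l_o)}_0\,(\tilde{\mathbf x}^{(l_i)})_0$, and, for $1\le m\le\min(l_i,l_o)$, $$\begin{pmatrix}(\mathbf w^{(l_o)}_{l_i})_{m}\\ (\mathbf w^{(l_o)}_{l_i})_{-m}\end{pmatrix}=\begin{pmatrix}\tilde{\mathbf h}^{(l_i,l_o)}_{m} & -\tilde{\mathbf h}^{(l_i,l_o)}_{-m}\\ \tilde{\mathbf h}^{(l_i,l_o)}_{-m} & \tilde{\mathbf h}^{(l_i,l_o)}_{m}\end{pmatrix}\begin{pmatrix}(\tilde{\mathbf x}^{(l_i)})_{m}\\ (\tilde{\mathbf x}^{(l_i)})_{-m}\end{pmatrix},$$ with all components $(\mathbf w^{(l_o)}_{l_i})_{\pm m}$, $m>\min(l_i,l_o)$, equal to $0$.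
   Context: Vectors in $\mathbb R^{2l+1}$ have components indexed by the order $m\in\{-l,\dots,l\}$. Real spherical harmonics with polar axis $y$: write $\hat{\mathbf r}=(\sin\theta\sin\phi,\cos\theta,\sin\theta\cos\phi)\in S^2$ with colatitude $\theta\in[0,\pi]$ and longitude $\phi$ (rotation about the $y$-axis). For $l\ge0$, $|m|\le l$, $$\mathbf Y^{(l)}_m(\hat{\mathbf r})=\begin{cases}P^{(l)}_m(\theta)\sin(m\phi)& m>0,\\ P^{(l)}_m(\theta)\cos(m\phi)& m\le0,\end{cases}$$ where $P^{(l)}_m(\theta)=N_{l,m}\,P_l^{|m|}(\cos\theta)$, $P_l^{|m|}$ is the associated Legendre function, $N_{l,0}=1$, and $N_{l,m}=\sqrt{2(l-|m|)!/(l+|m|)!}$ for $m\ne0$. Thus $P^{(l)}_{-m}=P^{(l)}_m$, all components of $\mathbf Y^{(l)}=(\mathbf Y^{(l)}_m)_m$ have the same $L^2(S^2)$ norm, and $\mathbf Y^{(l)}_m(0,1,0)=1$ if $m=0$ and $0$ otherwise. The Wigner matrix $\mathbf D^{(l)}(\mathbf R)\in\mathbb R^{(2l+1)\times(2l+1)}$ of $\mathbf R\in SO(3)$ is the (orthogonal) matrix with $\mathbf Y^{(l)}(\mathbf R\hat{\mathbf r})=\mathbf D^{(l)}(\mathbf R)\mathbf Y^{(l)}(\hat{\mathbf r})$ for all $\hat{\mathbf r}\in S^2$; $SO(3)$ acts on $\mathbb R^{2l+1}$ by $\mathbf D^{(l)}$ (the irreducible representation of degree $l$). For $|l_i-l_o|\le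 l_f\le l_i+l_o$, the generalized tensor product $\otimes^{l_o}_{l_i,l_f}:\mathbb R^{2l_i+1}\times\mathbb R^{2l_f+1}\to\mathbb R^{2l_o+1}$ is a fixed nonzero real bilinear $SO(3)$-equivariant map, i.e. $\mathbf D^{(l_o)}(\mathbf R)(\mathbf u\otimes^{l_o}_{l_i,l_f}\mathbf v)=(\mathbf D^{(l_i)}(\mathbf R)\mathbf u)\otimes^{l_o}_{l_i,l_f}(\mathbf D^{(l_f)}(\mathbf R)\mathbf v)$; it is unique up to a nonzero real scalar. The (real, $SO(3)$) Clebsch-Gordan coefficients $\mathbf C^{(l_o,m_o)}_{(l_i,m_i),(l_f,m_f)}\in\mathbb R$ are its structure constants: $$(\mathbf u\otimes^{l_o}_{l_i,l_f}\mathbf v)_{m_o}=\sum_{m_i,m_f}\mathbf u_{m_i}\,\mathbf C^{(l_o,m_o)}_{(l_i,m_i),(l_f,m_f)}\,\mathbf v_{m_f}.$$ *)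

(* Defs.v *)
From HB Require Import structures.
From mathcomp Require Import all_boot all_order all_algebra sesquilinear.
From mathcomp Require Import all_classical all_reals all_analysis.
From mathcomp Require Import ring lra zify.

Set Implicit Arguments.
Unset Strict Implicit.
Unset Printing Implicit Defensive.

Import Order.TTheory GRing.Theory Num.Theory.
Local Open Scope ring_scope.

(* The components of R^(2l+1) are indexed by the orders -l <= m <= l, the      *)
(* order m being stored at position m + l of a column vector.                  *)
Notation "''Vec[' R ]_ l" := 'cV[R]_(l.*2.+1)
  (at level 8, l at level 2, format "''Vec[' R ]_ l") : type_scope.

Definition order_of (l : nat) (i : 'I_(l.*2.+1)) : int := i%:Z - l%:Z.

(* Meaningful only for -l <= m <= l, the only case in which it is used.        *)
Definition pos_of (l : nat) (m : int) : 'I_(l.*2.+1) := inord `|(m + l%:Z)%R|%N.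

Definition cmp (R : realType) (l : nat) (v : 'Vec[R]_l) (m : int) : R :=
  v (pos_of l m) 0.

Definition vec (R : realType) (l : nat) (f : int -> R) : 'Vec[R]_l :=
  \col_i f (order_of i).

Definition ebasis (R : realType) (l : nat) (m : int) : 'Vec[R]_l :=
  delta_mx (pos_of l m) 0.

Lemma pos_ofK (l : nat) (m : int) :
  (`|m|%N <= l)%N -> order_of (pos_of l m) = m.
Proof.
move=> hm; rewrite /order_of /pos_of inordK; first by lia.
by rewrite ltnS -addnn; lia.
Qed.

Lemma order_ofK (l : nat) (i : 'I_(l.*2.+1)) : pos_of l (order_of i) = i.
Proof. by rewrite /pos_of /order_of subrK /= inord_val. Qed.

Definition legendre (R : realType) (l : nat) : {poly R} :=
  (2 ^+ l * (l`!)%:R)^-1 *: (('X^2 - 1) ^+ l)^`(l).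

(* No Condon-Shortley phase (-1)^m; used for |t| <= 1.                         *)
Definition assoc_legendre (R : realType) (l m : nat) (t : R) : R :=
  Num.sqrt (1 - t ^+ 2) ^+ m * ((legendre R l)^`(m)).[t].

Definition sh_norm (R : realType) (l : nat) (m : int) : R :=
  if m == 0 then 1
  else Num.sqrt (2 * ((l - `|m|%N)`!)%:R / ((l + `|m|%N)`!)%:R).

Definition sh_polar (R : realType) (l : nat) (m : int) (theta : R) : R :=
  sh_norm R l m * assoc_legendre l `|m|%N (cos theta).

Definition sh_angles (R : realType) (l : nat) (m : int) (theta phi : R) : R :=
  if 0 < m then sh_polar l m theta * sin (m%:~R * phi)
  else sh_polar l m theta * cos (m%:~R * phi).

(* A point (x, y, z) of R^3 is a column vector, with polar axis y in row 1.    *)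
Definition cx (R : realType) (r : 'cV[R]_3) : R := r 0 0.
Definition cy (R : realType) (r : 'cV[R]_3) : R := r 1 0.
Definition cz (R : realType) (r : 'cV[R]_3) : R := r 2 0.

Definition S2 (R : realType) (r : 'cV[R]_3) : Prop :=
  cx r ^+ 2 + cy r ^+ 2 + cz r ^+ 2 = 1.

Definition pole (R : realType) : 'cV[R]_3 := delta_mx 1 0.

Definition sphere_point (R : realType) (theta phi : R) : 'cV[R]_3 :=
  \col_i (if i == 0 then sin theta * sin phi
          else if i == 1 then cos theta else sin theta * cos phi).

(* The colatitude in [0, pi] and the longitude in ]-pi, pi] of a point of S2.  *)
(* At the poles the longitude is arbitrary, but the harmonics do not depend on *)
(* it there: see sphere_pointK and sph_harmE below.                            *)
Definition colatitude (R : realType) (r : 'cV[R]_3) : R := acos (cy r).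

Definition longitude (R : realType) (r : 'cV[R]_3) : R :=
  let phi := acos (cz r / sin (colatitude r)) in
  if 0 <= cx r then phi else - phi.

Lemma sphere_pointK (R : realType) (r : 'cV[R]_3) :
  S2 r -> sphere_point (colatitude r) (longitude r) = r.
Proof.
rewrite /S2 => hr.
have hy : -1 <= cy r <= 1 by apply/andP; split; nra.
have hs : sin (colatitude r) ^+ 2 = cx r ^+ 2 + cz r ^+ 2.
  by rewrite sin_acos // sqr_sqrtr; nra.
have hs0 : 0 <= sin (colatitude r) by rewrite sin_acos // sqrtr_ge0.
have hc : cos (colatitude r) = cy r by rewrite acosK // in_itv.
suff [hX hZ] : sin (colatitude r) * sin (longitude r) = cx r /\
    sin (colatitude r) * cos (longitude r) = cz r.
  apply/colP => i; rewrite mxE hX hZ hc /cx /cy /cz.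
  case: eqP => [->//|/eqP h0]; case: eqP => [->//|/eqP h1].
  by congr (r _ _); apply/val_inj; case: i h0 h1 => [[|[|[|]]]].
rewrite /longitude; move: hs hs0; set s := sin _ => hs hs0.
have [s0|s0] := eqVneq s 0.
  have x0 : cx r = 0 by move: hs; rewrite s0; nra.
  have z0 : cz r = 0 by move: hs; rewrite s0; nra.
  by rewrite s0 x0 z0 !mul0r.
have sp : 0 < s by rewrite lt_def s0.
have hzs : -1 <= cz r / s <= 1.
  by rewrite ler_pdivlMr // ler_pdivrMr //; apply/andP; split; nra.
have hcos : s * cos (acos (cz r / s)) = cz r.
  by rewrite acosK ?in_itv // mulrC divfK.
have hsin : s * sin (acos (cz r / s)) = `|cx r|.
  rewrite sin_acos // -{1}(ger0_norm hs0) -(sqrtr_sqr s) -sqrtrM ?sqr_ge0 //.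
  suff -> : s ^+ 2 * (1 - (cz r / s) ^+ 2) = cx r ^+ 2 by rewrite sqrtr_sqr.
  by rewrite mulrBr mulr1 -exprMn mulrCA divff // mulr1 hs addrK.
case: (lerP 0 (cx r)) => hx; rewrite ?cosN ?sinN ?mulrN hcos hsin.
  by rewrite ger0_norm.
by rewrite ltr0_norm // opprK.
Qed.

Definition sph_harm (R : realType) (l : nat) (r : 'cV[R]_3) : 'Vec[R]_l :=
  vec l (fun m => sh_angles l m (colatitude r) (longitude r)).

Lemma trig_mul_eq (R : realType) (p q : R) (m : int) :
  sin p = sin q -> cos p = cos q ->
  sin (m%:~R * p) = sin (m%:~R * q) /\ cos (m%:~R * p) = cos (m%:~R * q).
Proof.
move=> hs hc.
have H (n : nat) : sin (n%:R * p) = sin (n%:R * q) /\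
    cos (n%:R * p) = cos (n%:R * q).
  elim: n => [|n [IHs IHc]]; first by rewrite !mul0r.
  by rewrite -natr1 !mulrDl !mul1r !sinD !cosD IHs IHc hs hc.
case: m => n; first exact: H.
have [Hs Hc] := H n.+1.
by rewrite NegzE mulrNz !mulNr !sinN !cosN Hs Hc.
Qed.

Lemma sph_harmE (R : realType) (l : nat) (theta phi : R) :
  0 <= theta <= pi ->
  sph_harm l (sphere_point theta phi) = vec l (fun m => sh_angles l m theta phi).
Proof.
move=> ht; have hS : S2 (sphere_point theta phi).
  rewrite /S2 /cx /cy /cz !mxE /= !exprMn.
  have := cos2Dsin2 theta; have := cos2Dsin2 phi; nra.
have hth : colatitude (sphere_point theta phi) = theta.
  by rewrite /colatitude /cy mxE /= cosK // in_itv.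
have hK := sphere_pointK hS.
rewrite /sph_harm hth; rewrite hth in hK.
move: (longitude _) hK => phi' hK.
have hx := congr1 (fun v : 'cV[R]_3 => v 0 0) hK.
have hz := congr1 (fun v : 'cV[R]_3 => v 2 0) hK.
rewrite !mxE /= in hx hz.
apply/colP => i; rewrite !mxE; set m := order_of i.
rewrite /sh_angles; have [s0|s0] := eqVneq (sin theta) 0; last first.
  by have [-> ->] := trig_mul_eq m (mulfI s0 hx) (mulfI s0 hz).
have [m0|m0] := eqVneq m 0; first by rewrite m0 /= !mul0r.
suff -> : sh_polar l m theta = 0 by rewrite !mul0r.
rewrite /sh_polar /assoc_legendre -sin2cos2 s0 expr0n sqrtr0 expr0n.
by rewrite absz_eq0 (negbTE m0) mul0r mulr0.
Qed.

Definition SO3 (R : realType) (A : 'M[R]_3) : Prop :=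
  A^T *m A = 1%:M /\ \det A = 1.

(* The matrix characterised by Y (A r) = D Y (r) for all r on the sphere; the  *)
(* default value 0 is irrelevant when A is a rotation, since then such a       *)
(* matrix exists (and it is unique).                                           *)
Definition wigner (R : realType) (l : nat) (A : 'M[R]_3) : 'M[R]_(l.*2.+1) :=
  xget 0 [set D : 'M[R]_(l.*2.+1) |
    forall r : 'cV[R]_3, S2 r -> sph_harm l (A *m r) = D *m sph_harm l r]%classic.

Definition admissible (li lf lo : nat) : bool :=
  (`|li%:Z - lo%:Z|%N <= lf <= li + lo)%N.

Definition tensor_product_axiom (R : realType) (li lf lo : nat)
    (T : {bilinear 'Vec[R]_li -> 'Vec[R]_lf -> 'Vec[R]_lo}) : Prop :=
  (exists u v, T u v != 0) /\
  (forall A : 'M[R]_3, SO3 A -> forall u v,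
     wigner lo A *m T u v = T (wigner li A *m u) (wigner lf A *m v)).

(* clebsch_gordan T mo mi mf is C^(lo,mo)_((li,mi),(lf,mf)).                   *)
Definition clebsch_gordan (R : realType) (li lf lo : nat)
    (T : {bilinear 'Vec[R]_li -> 'Vec[R]_lf -> 'Vec[R]_lo})
    (mo mi mf : int) : R :=
  cmp (T (ebasis R li mi) (ebasis R lf mf)) mo.

Lemma clebsch_gordanE (R : realType) (li lf lo : nat)
    (T : {bilinear 'Vec[R]_li -> 'Vec[R]_lf -> 'Vec[R]_lo})
    (u : 'Vec[R]_li) (v : 'Vec[R]_lf) (mo : int) :
  cmp (T u v) mo =
  \sum_(i < li.*2.+1) \sum_(j < lf.*2.+1)
    cmp u (order_of i) * clebsch_gordan T mo (order_of i) (order_of j)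
      * cmp v (order_of j).
Proof.
rewrite {1}(matrix_sum_delta u) {1}(matrix_sum_delta v).
rewrite linear_sumlz /cmp summxE; apply: eq_bigr => i _.
rewrite big_ord1 linearZl_LR linear_sumr mxE summxE mulr_sumr.
apply: eq_bigr => j _.
rewrite big_ord1 linearZr_LR mxE /clebsch_gordan /cmp /ebasis !order_ofK.
by rewrite [X in _ * X]mulrC mulrA.
Qed.

Section Convolution.
Variables (R : realType) (L : nat).
Variable T : forall li lf lo : nat,
  {bilinear 'Vec[R]_li -> 'Vec[R]_lf -> 'Vec[R]_lo}.
Variable h : nat -> nat -> nat -> R. (* h li lf lo *)

Definition equiv_conv (x : forall l : nat, 'Vec[R]_l) (r : 'cV[R]_3)
    (lo : nat) : 'Vec[R]_lo :=
  \sum_(0 <= li < L.+1) \sum_(`|li%:Z - lo%:Z|%N <= lf < (li + lo).+1)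
    T li lf lo (x li) (h li lf lo *: sph_harm lf r).

Definition cg_diag (li lf lo : nat) (m : int) : R :=
  if 0 <= m then clebsch_gordan (T li lf lo) m m 0
  else clebsch_gordan (T li lf lo) m (- m) 0.

Definition htilde (li lo : nat) (m : int) : R :=
  \sum_(`|li%:Z - lo%:Z|%N <= lf < (li + lo).+1)
    h li lf lo * cg_diag li lf lo m.

(* The last two branches are the first and second rows, for the pair of orders *)
(* (k, -k) with k = |m|, of the 2 x 2 matrix                                   *)
(* [[htilde k, - htilde (-k)], [htilde (-k), htilde k]].                       *)
Definition so2_conv (li lo : nat) (x : 'Vec[R]_li) : 'Vec[R]_lo :=
  vec lo (fun m : int =>
    if (minn li lo < `|m|%N)%N then 0
    else if m == 0 then htilde li lo 0 * cmp x 0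
    else if 0 < m then
      htilde li lo m * cmp x m - htilde li lo (- m) * cmp x (- m)
    else
      htilde li lo m * cmp x (- m) + htilde li lo (- m) * cmp x m).

End Convolution.

(* Main.v *)
Require Import Defs.
From HB Require Import structures.
From mathcomp Require Import all_boot all_order all_algebra sesquilinear.
From mathcomp Require Import all_classical all_reals all_analysis.
From mathcomp Require Import ring lra zify complex.

Set Implicit Arguments.
Unset Strict Implicit.
Unset Printing Implicit Defensive.

Import Order.TTheory GRing.Theory Num.Theory.
Local Open Scope ring_scope.

(* Equivariance reduces the statement to r = (0,1,0), where Y^(l_f) is the     *)
(* basis vector e_0. The map u |-> u (x) e_0 then commutes with the rotations  *)
(* about the y-axis, which act on the pair of orders (m, -m) as plane          *)
(* rotations by the angle m alpha; comparing the actions of alpha and - alpha  *)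
(* leaves only the 2 x 2 blocks of the statement.                              *)
(*                                                                             *)
(* The existence of Wigner matrices is obtained from a generating function:    *)
(* with a = i(z - ix), b = 2y and c = i(z + ix), the coefficients of           *)
(* (a + b t + c t^2)^l are, by Taylor's formula for (X^2 - 1)^l at y, nonzero  *)
(* multiples of the combinations Y_{-m} + i Y_m and Y_{-m} - i Y_m.            *)
(* Now a + b t + c t^2 is the scalar product of r with a null vector of        *)
(* C[t]^3; an orthogonal matrix turns it into another null vector, so that the *)
(* l-th power of the new scalar product is a combination of the same           *)
(* coefficients.                                                               *)

(** * Powers of trinomials *)

(** Since [wigner] is obtained by choice, the harmonics must first be shown to determine it. A
    matrix with the required property exists ([wigner_exists], resting on [trinom_cone] and
    [null_form_rot]), and it is unique because the components of Y^(l) are linearly independent on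
    the sphere ([sph_harm_free]). Uniqueness computes D for rotations about the y-axis
    ([wigner_rotyE]) and gives D(R^-1) D(R) = 1 ([wigner_invmx]).

    Let N be the matrix of u |-> u (x) e_0. It intertwines these axial rotations
    ([clebsch_gordan_roty]), so entries with |m_o| different from |m_i| vanish
    ([clebsch_gordan_offdiag]) and each remaining block commutes with a quarter turn
    ([clebsch_gordan_sym]). Summing over l_f gives the SO(2) form ([so2_convE]). *)

Section Trinomial.
Variable K : comNzRingType.
Implicit Types (a b c y : K) (p q s : {poly K}).

Definition trinom a b c : {poly K} := a%:P + b *: 'X + c *: 'X^2.

(* For p = u^2, q = u v, s = v^2 this is u^d v^(2l-d); a polynomial in p, q, s *)
(* is needed because a general null vector gives only q^2 = p s.               *)
Definition cone_mono p q s (l d : nat) : {poly K} :=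
  p ^+ d./2 * q ^+ odd d * s ^+ (l - uphalf d).

Lemma size_trinomX a b c l : (size (trinom a b c ^+ l)%R <= l.*2.+1)%N.
Proof.
have h : (size (trinom a b c) <= 3)%N.
  rewrite /trinom; apply: leq_trans (size_polyD _ _) _; rewrite geq_max; apply/andP; split.
    apply: leq_trans (size_polyD _ _) _; rewrite geq_max size_polyC.
    by rewrite (leq_trans (size_scale_leq _ _)) ?size_polyX //; case: (_ == _).
  by rewrite (leq_trans (size_scale_leq _ _)) ?size_polyXn.
apply: leq_trans (size_poly_exp_leq _ _) _; rewrite ltnS -mul2n leq_mul2r.
by apply/orP; right; case: (size _) h => [|[|[|]]].
Qed.

Lemma cone_mono_s p q s l d : (d <= l.*2)%N ->
  cone_mono p q s l.+1 d = s * cone_mono p q s l d.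
Proof.
move=> hd; rewrite /cone_mono subSn ?exprS; first by ring.
by rewrite uphalf_half; lia.
Qed.

Lemma cone_mono_p p q s l d : cone_mono p q s l.+1 d.+2 = p * cone_mono p q s l d.
Proof. by rewrite /cone_mono /= negbK subSS exprS; ring. Qed.

Lemma cone_mono_q p q s l d : q ^+ 2 = p * s -> (d <= l.*2)%N ->
  cone_mono p q s l.+1 d.+1 = q * cone_mono p q s l d.
Proof.
move=> hq hd; have od := odd_double_half d.
rewrite /cone_mono; case: (boolP (odd d)) od => /= odd_d od; rewrite odd_d /=.
  have -> : (uphalf d = d./2.+1)%N by rewrite uphalf_half odd_d.
  rewrite ?subSS.
  have -> : (l - d./2 = (l - d./2.+1).+1)%N by lia.
  rewrite !exprS !expr0 !mulr1.
  transitivity (p * s * (p ^+ d./2 * s ^+ (l - d./2.+1))); first by ring.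
  by rewrite -hq; ring.
have -> : (uphalf d = d./2)%N by rewrite uphalf_half (negbTE odd_d).
by rewrite subSS expr0 expr1; ring.
Qed.

(** This is the expansion of (a + b t + c t^2)^l at t = u/v, multiplied by v^(2l). With no u and v
    at hand it goes by induction on l: multiplying by s, q, p raises the degree in u by 0, 1, 2,
    which is the content of the three lemmas above. *)
Lemma trinom_cone a b c p q s l : q ^+ 2 = p * s ->
  (a *: s + b *: q + c *: p) ^+ l =
  \sum_(d < l.*2.+1) ((trinom a b c ^+ l)`_d) *: cone_mono p q s l d.
Proof.
move=> hq; elim: l => [|l IHl].
  by rewrite big_ord1 expr0 coefC eqxx scale1r /cone_mono !mulr1.
rewrite exprS IHl doubleS; set Q := trinom a b c ^+ l.
have Qbig k : (l.*2 < k)%N -> Q`_k = 0.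
  by move=> hk; rewrite nth_default // (leq_trans (size_trinomX _ _ _ _)).
have coefQ d : (trinom a b c ^+ l.+1)`_d =
    a * Q`_d + b * ('X * Q)`_d + c * ('X^2 * Q)`_d.
  by rewrite exprS -/Q /trinom !mulrDl !coefD coefCM -!scalerAl !coefZ.
rewrite (eq_bigr (fun d : 'I_l.*2.+3 =>
    a *: (Q`_d *: cone_mono p q s l.+1 d)
  + b *: (('X * Q)`_d *: cone_mono p q s l.+1 d)
  + c *: (('X^2 * Q)`_d *: cone_mono p q s l.+1 d))); last first.
  by move=> d _; rewrite coefQ !scalerDl !scalerA.
rewrite !big_split /= -!scaler_sumr !mulrDl -!scalerAl !mulr_sumr.
congr (a *: _ + b *: _ + c *: _).
- rewrite [RHS]big_ord_recr [X in _ = X + _]big_ord_recr /= !Qbig // !scale0r !addr0.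
  by apply: eq_bigr => d _; rewrite cone_mono_s -?scalerAr // -ltnS.
- rewrite [RHS]big_ord_recl [X in _ = _ + X]big_ord_recr /= !coefXM /= Qbig //.
  rewrite !scale0r add0r addr0; apply: eq_bigr => d _.
  by rewrite coefXM /= cone_mono_q -?scalerAr // -ltnS.
- rewrite [RHS]big_ord_recl [X in _ = _ + X]big_ord_recl /= !coefXnM /=.
  rewrite !scale0r !add0r; apply: eq_bigr => d _.
  by rewrite coefXnM /= /bump /= !add1n !subSS subn0 cone_mono_p -scalerAr.
Qed.

(** The substitution t -> 1/t, that is, [trinom_cone] with p = 1, q = X, s = X^2. *)
Lemma trinom_coef_rev a b c l k j : (k + j = l.*2)%N ->
  (trinom a b c ^+ l)`_k = (trinom c b a ^+ l)`_j.
Proof.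
move=> hkj.
have h : ('X : {poly K}) ^+ 2 = 1 * 'X^2 by rewrite mul1r.
have := congr1 (fun P : {poly K} => P`_j) (trinom_cone a b c l h).
have -> : a *: 'X^2 + b *: 'X + c *: 1 = trinom c b a.
  by rewrite /trinom alg_polyC addrC addrA addrAC -addrA.
move=> ->; rewrite coef_sum.
have hk : (k < l.*2.+1)%N by lia.
rewrite (bigD1 (Ordinal hk)) //= big1 ?addr0 => [|d /eqP hd].
  rewrite coefZ /cone_mono expr1n mul1r -exprM -exprD coefXn.
  by rewrite (_ : (j == _) = true) ?mulr1 //; rewrite uphalf_half; have := odd_double_half k; lia.
rewrite coefZ /cone_mono expr1n mul1r -exprM -exprD coefXn.
rewrite (_ : (j == _) = false) ?mulr0 //; apply/negbTE/eqP => hj.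
apply: hd; apply: val_inj => /=; move: hj.
by have := ltn_ord d; rewrite uphalf_half; have := odd_double_half d; lia.
Qed.

(** The substitution t -> c t turns c times the trinomial into one with leading coefficient 1,
    without dividing by c. *)
Lemma trinom_coef_scale a b c l k : (k <= l.*2)%N ->
  c ^+ l * (trinom a b c ^+ l)`_k = c ^+ k * (trinom (a * c) b 1 ^+ l)`_k.
Proof.
move=> hkl.
have h : (c *: 'X : {poly K}) ^+ 2 = (c ^+ 2 *: 'X^2) * 1 by rewrite mulr1 exprZn.
have := congr1 (fun P : {poly K} => P`_k) (trinom_cone (a * c) b 1 l h).
have -> : (a * c) *: 1 + b *: (c *: 'X) + 1 *: (c ^+ 2 *: 'X^2) = c *: trinom a b c.
  by rewrite /trinom -[a%:P]alg_polyC !scalerDr !scalerA mul1r [c * a]mulrC [c * b]mulrC expr2.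
rewrite exprZn coefZ => ->; rewrite coef_sum.
have hk : (k < l.*2.+1)%N by lia.
have cmE d : cone_mono (c ^+ 2 *: 'X^2) (c *: 'X) 1 l d = c ^+ d *: 'X^d.
  rewrite /cone_mono expr1n mulr1 -exprZn -!exprM -exprD exprZn.
  by rewrite (_ : (2 * d./2 + odd d)%N = d) //; have := odd_double_half d; lia.
rewrite (bigD1 (Ordinal hk)) //= big1 ?addr0 => [|d /eqP hd].
  by rewrite cmE !coefZ coefXn eqxx mulr1 mulrC.
rewrite cmE !coefZ coefXn (_ : (k == d) = false) ?mulr0 //.
by apply/negbTE/eqP => hj; apply: hd; apply: val_inj.
Qed.

Lemma coef_comp_shift P y k : (P \Po (y%:P + 'X))`_k = P^`N(k).[y].
Proof.
rewrite /comp_poly nderiv_taylor; last exact: mulrC.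
rewrite size_map_inj_poly //; last exact: polyC_inj.
under eq_bigr do rewrite nderivn_map horner_map mul_polyC /=.
rewrite -(poly_def (size P) (fun i => P^`N(i).[y])) coef_poly; case: ltnP => // hk.
by rewrite nderivn_poly0 // horner0.
Qed.

(** The trinomial is (y + X)^2 - 1, so its powers are Taylor expansions at y. *)
Lemma trinom_taylor y l k :
  (trinom (y ^+ 2 - 1) (y *+ 2) 1 ^+ l)`_k = (('X^2 - 1) ^+ l)^`N(k).[y].
Proof.
rewrite -coef_comp_shift rmorphXn /= rmorphB rmorphXn /= comp_polyX comp_polyC.
congr ((_ ^+ _ : {poly K})`_k); rewrite /trinom scale1r polyCB polyC_exp -mul_polyC polyCMn sqrrD.
by rewrite mulrnAl; ring.
Qed.

End Trinomial.

Lemma trinom_coef_hi (K : fieldType) (a c y : K) l m : (m <= l)%N ->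
  a * c = y ^+ 2 - 1 -> (c = 0 -> a = 0) ->
  (trinom a (y *+ 2) c ^+ l)`_(l + m) = c ^+ m * (('X^2 - 1) ^+ l)^`N(l + m).[y].
Proof.
move=> hm hac ha; have [c0|c0] := eqVneq c 0; last first.
  apply: (mulfI (expf_neq0 l c0)); rewrite trinom_coef_scale ?hac; last by lia.
  by rewrite trinom_taylor exprD mulrA.
(* Here c = 0, which on the sphere means a pole: both sides vanish for m > 0 and equal (2y)^l for m
   = 0. *)
move: hac; rewrite ha // c0 mul0r => hy; rewrite -trinom_taylor -hy.
have -> : trinom 0 (y *+ 2) 0 = (y *+ 2) *: 'X by rewrite /trinom scale0r addr0 add0r.
have -> : trinom 0 (y *+ 2) 1 = 'X * ((y *+ 2)%:P + 'X).
  by rewrite /trinom add0r scale1r -mul_polyC; ring.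
rewrite exprZn coefZ coefXn exprMn coefXnM ltnNge leq_addr /=.
case: m hm => [|m] hm.
  rewrite addn0 eqxx mulr1 expr0 mul1r subnn -horner_coef0 horner_exp.
  by rewrite hornerD hornerC hornerX addr0.
by rewrite expr0n mul0r -[X in _ == X]addn0 eqn_add2l mulr0.
Qed.

Lemma trinom_coef_lo (K : fieldType) (a c y : K) l m : (m <= l)%N ->
  a * c = y ^+ 2 - 1 -> (a = 0 -> c = 0) ->
  (trinom a (y *+ 2) c ^+ l)`_(l - m) = a ^+ m * (('X^2 - 1) ^+ l)^`N(l + m).[y].
Proof.
move=> hm hac hc; rewrite -(trinom_coef_hi (a := c)) 1?mulrC //.
by apply: trinom_coef_rev; lia.
Qed.

(** * Linear independence of spherical harmonics *)

Section Components.
Variable R : realType.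
Implicit Types (l : nat) (m : int) (al theta phi : R).

Lemma abs_order_of l (i : 'I_l.*2.+1) : (`|order_of i|%N <= l)%N.
Proof. by rewrite /order_of; have := ltn_ord i; lia. Qed.

Lemma order_of_inj l : injective (@order_of l).
Proof. by move=> i j h; rewrite -(order_ofK i) h order_ofK. Qed.

Lemma cmpE l (v : 'Vec[R]_l) i : v i 0 = cmp v (order_of i).
Proof. by rewrite /cmp order_ofK. Qed.

Lemma cmp_vec l (f : int -> R) m : (`|m|%N <= l)%N -> cmp (vec l f) m = f m.
Proof. by move=> hm; rewrite /cmp mxE pos_ofK. Qed.

Lemma eq_cmp l (u v : 'Vec[R]_l) :
  (forall m, (`|m|%N <= l)%N -> cmp u m = cmp v m) -> u = v.
Proof. by move=> h; apply/colP => i; rewrite !cmpE h ?abs_order_of. Qed.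

Definition trig m phi : R := if 0 < m then sin (m%:~R * phi) else cos (m%:~R * phi).

Lemma sh_anglesE l m theta phi :
  sh_angles l m theta phi = sh_polar l m theta * trig m phi.
Proof. by rewrite /sh_angles /trig; case: ifP. Qed.

Lemma sphereP (r : 'cV[R]_3) : S2 r ->
  exists theta phi, 0 <= theta <= pi /\ r = sphere_point theta phi.
Proof.
move=> hr; exists (colatitude r), (longitude r); split; last by rewrite sphere_pointK.
have hy : -1 <= cy r <= 1 by move: hr; rewrite /S2 => hr; apply/andP; split; nra.
by rewrite /colatitude acos_ge0 ?acos_lepi.
Qed.

Lemma S2_sphere_point theta phi : S2 (sphere_point theta phi).
Proof.
rewrite /S2 /cx /cy /cz !mxE /= !exprMn.
by have := cos2Dsin2 theta; have := cos2Dsin2 phi; nra.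
Qed.

Lemma cmp_sph_harm l m theta phi : (`|m|%N <= l)%N -> 0 <= theta <= pi ->
  cmp (sph_harm l (sphere_point theta phi)) m = sh_polar l m theta * trig m phi.
Proof. by move=> hm ht; rewrite sph_harmE // cmp_vec // sh_anglesE. Qed.

Definition sh_const l m : R :=
  sh_norm R l m * ((2 ^+ l * (l`!)%:R)^-1 * ((l + `|m|)`!)%:R).

Lemma sh_const_neq0 l m : (`|m|%N <= l)%N -> sh_const l m != 0.
Proof.
move=> hm; have fact0 n : (n`!)%:R != 0 :> R by rewrite pnatr_eq0 -lt0n fact_gt0.
rewrite /sh_const; apply: mulf_neq0; last first.
  by apply: mulf_neq0 => //; rewrite invr_eq0 mulf_neq0 // expf_neq0 // pnatr_eq0.
rewrite /sh_norm; case: ifP => _; first exact: oner_neq0.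
by rewrite gt_eqF // sqrtr_gt0 divr_gt0 ?mulr_gt0 ?ltr0n ?fact_gt0.
Qed.

Lemma sh_constN l m : sh_const l (- m) = sh_const l m.
Proof. by rewrite /sh_const /sh_norm oppr_eq0 abszN. Qed.

Lemma sh_polarE l m theta : 0 <= theta <= pi ->
  sh_polar l m theta = sh_const l m *
    (sin theta ^+ `|m| * (('X^2 - 1) ^+ l)^`N(l + `|m|).[cos theta]).
Proof.
move=> ht; have hs : Num.sqrt (1 - cos theta ^+ 2) = sin theta.
  by rewrite -sin2cos2 sqrtr_sqr ger0_norm // sin_ge0_pi // in_itv.
rewrite /sh_polar /assoc_legendre hs /sh_const /legendre derivnZ hornerZ.
rewrite /derivn -iterD -/(derivn _ _) nderivn_def addnC hornerMn.
by rewrite -[_ *+ (_)`!]mulr_natr; ring.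
Qed.

(** The coefficient of degree l - m is the binomial of 2l over l + m. *)
Lemma nderivn_neq0 l (m : nat) : (m <= l)%N -> (('X^2 - 1 : {poly R}) ^+ l)^`N(l + m) != 0.
Proof.
move=> hm; apply/eqP => /(congr1 (fun p : {poly R} => p`_(l - m))).
rewrite coef_nderivn coef0 (_ : (l + m + (l - m))%N = (2 * l)%N); last by lia.
have -> : (('X^2 - 1 : {poly R}) ^+ l)`_(2 * l) = 1.
  have mon : ('X^2 - 1 : {poly R}) \is monic by rewrite -polyC1 monicXnsubC.
  have := monic_exp l mon; rewrite monicE /lead_coef size_exp.
  by rewrite -polyC1 size_XnsubC // => /eqP.
by move/eqP; rewrite pnatr_eq0; apply/negP; rewrite -lt0n bin_gt0; lia.
Qed.

Lemma poly_neq0_itv (p : {poly R}) : p != 0 -> exists2 t, -1 < t < 1 & p.[t] != 0.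
Proof.
move=> p0; apply: contrapT => hn.
(* As many distinct points of ]0, 1[ as the size of p, hence more than its degree: they cannot all
   be roots. *)
pose rs : seq R := [seq (i.+2%:R)^-1 | i <- iota 0 (size p)].
have : (size rs < size p)%N.
  apply: max_poly_roots => //.
    apply/allP => _ /mapP [i _ ->]; rewrite /root; apply/negP => hr; apply: hn.
    exists (i.+2%:R)^-1; last exact/negP.
    have i0 : 0 < (i.+2%:R)^-1 :> R by rewrite invr_gt0 ltr0n.
    have -> : -1 < (i.+2%:R)^-1 :> R by rewrite (lt_trans _ i0) // oppr_lt0.
    by rewrite invf_lt1 ?ltr1n ?ltr0n.
  rewrite map_inj_uniq ?iota_uniq // => i j /invr_inj /eqP.
  by rewrite eqr_nat => /eqP [].
by rewrite size_map size_iota ltnn.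
Qed.

Lemma trigDB m phi al :
  trig m (phi + al) + trig m (phi - al) = cos (m%:~R * al) *+ 2 * trig m phi.
Proof.
rewrite /trig !mulrDr !mulrN; case: ifP => _;
  by rewrite ?sinD ?cosD ?sinN ?cosN; ring.
Qed.

(** The multiples of pi/(N+1) up to the N-th stay in [0, pi], where the cosine is injective; one
    angle thus separates all values of |m| up to N. *)
Lemma cos_order_neq (N : nat) m n : (`|m| <= N)%N -> (`|n| <= N)%N -> `|m|%N != `|n|%N ->
  cos (m%:~R * (pi / N.+1%:R)) != cos (n%:~R * (pi / N.+1%:R)) :> R.
Proof.
move=> hm hn hmn.
have cosabs k : cos (k%:~R * (pi / N.+1%:R)) = cos ((`|k|%N)%:R * (pi / N.+1%:R)) :> R.
  by case: k => k //; rewrite NegzE /= mulrNz mulNr cosN.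
rewrite !cosabs; apply: contra hmn => /eqP /cos_inj h.
have itv (k : nat) : (k <= N)%N -> (k%:R * (pi / N.+1%:R) : R) \in `[0, pi].
  move=> hk; rewrite in_itv /= mulrA mulrAC; apply/andP; split.
    by rewrite !mulr_ge0 ?pi_ge0 ?invr_ge0.
  rewrite ler_piMl ?pi_ge0 // ler_pdivrMr ?ltr0n // mul1r ler_nat; lia.
have /eqP := h (itv _ hm) (itv _ hn).
have piN : (pi / N.+1%:R : R) != 0 by rewrite mulf_neq0 ?invr_eq0 ?pnatr_eq0 // gt_eqF // pi_gt0.
by rewrite (inj_eq (mulIf piN)) eqr_nat.
Qed.

(** Separates orders m and -m, whose harmonics share the same polar factor. *)
Lemma trig_dual m : exists phi, trig m phi = 1 /\
  (forall n, `|n|%N = `|m|%N -> n != m -> trig n phi = 0).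
Proof.
have [m0|m0] := leP m 0.
  exists 0; split=> [|n hn nm]; rewrite /trig mulr0 ?cos0 ?sin0.
    by rewrite ltNge m0.
  by rewrite (_ : 0 < n) //; lia.
exists (pi / 2 / m%:~R); rewrite /trig m0.
have mi0 : (m%:~R : R) != 0 by rewrite intr_eq0; lia.
have hh : m%:~R * (pi / 2 / m%:~R) = pi / 2 :> R by rewrite mulrC divfK.
split=> [|n hn nm]; first by rewrite hh sin_pihalf.
have -> : n = - m by lia.
by rewrite (_ : 0 < - m = false) ?mulrNz ?mulNr ?hh ?cosN ?cos_pihalf //; lia.
Qed.

(** Averaging over the longitudes phi + al and phi - al acts on order m as multiplication by cos(m
    al). A polynomial in this operator isolates one value of |m|; a suitable longitude then isolates
    the sign, and a suitable colatitude makes the polar factor nonzero. *)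
Lemma sph_harm_free l n (M : 'M[R]_(n, l.*2.+1)) :
  (forall r, S2 r -> M *m sph_harm l r = 0) -> M = 0.
Proof.
move=> hM; apply/matrixP => k i0; rewrite mxE.
set al : R := pi / l.+1%:R.
pose P (g : int -> R) := forall theta phi, 0 <= theta <= pi ->
  \sum_i g (order_of i) * (M k i * (sh_polar l (order_of i) theta * trig (order_of i) phi)) = 0.
have P1 : P (fun=> 1).
  move=> theta phi ht.
  have := congr1 (fun v : 'cV[R]_n => v k 0) (hM _ (S2_sphere_point theta phi)).
  rewrite !mxE => h; rewrite -[RHS]h; apply: eq_bigr => i _.
  by rewrite mul1r cmpE cmp_sph_harm ?abs_order_of.
have Pstep g kap : P g -> P (fun m => (cos (m%:~R * al) - kap) * g m).
  move=> hg theta phi ht.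
  have := congr2 (fun u v : R => 2^-1 * u - kap * v)
    (congr2 +%R (hg theta (phi + al) ht) (hg theta (phi - al) ht)) (hg theta phi ht).
  rewrite addr0 !mulr0 subr0 => h; rewrite -[RHS]h.
  rewrite -big_split /= !mulr_sumr -sumrB; apply: eq_bigr => i _.
  rewrite -!mulrDr trigDB; set c := cos _; set t := trig _ _.
  by rewrite -mulr_natl; field.
(* Lagrange-style product: with [ks] listing all degrees up to l other than |m|, it kills every
   order except m and -m. *)
pose G (ks : seq nat) (m : int) : R :=
  \prod_(j <- ks) (cos (m%:~R * al) - cos (j%:R * al)).
have Pseq ks : P (G ks).
  elim: ks => [|j ks IH] theta phi ht.
    by rewrite -[RHS](P1 theta phi ht); apply: eq_bigr => i _; rewrite /G big_nil.
  rewrite -[RHS](Pstep _ (cos (j%:R * al)) IH theta phi ht).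
  by apply: eq_bigr => i _; rewrite /G big_cons.
set m := order_of i0; have hm : (`|m| <= l)%N := abs_order_of i0.
have {Pseq} := Pseq [seq j <- iota 0 l.+1 | j != `|m|%N]; set g := G _ => Pg.
have gm : g m != 0.
  rewrite /g /G big_filter prodf_seq_neq0; apply/allP => j; rewrite mem_iota => hj.
  apply/implyP => jm; rewrite subr_eq0.
  by apply: (@cos_order_neq l m j) => //; rewrite 1?eq_sym // -ltnS.
have gn (m' : int) : (`|m'| <= l)%N -> `|m'|%N != `|m|%N -> g m' = 0.
  move=> hn nm; apply/eqP; rewrite /g /G big_filter prodf_seq_eq0; apply/hasP.
  exists `|m'|%N; first by rewrite mem_iota; lia.
  rewrite nm /= subr_eq0; apply/eqP.
  by case: m' {hn nm} => k' //; rewrite NegzE /= mulrNz mulNr cosN.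
have [phi [tm tn]] := trig_dual m.
have [t ht pt] := poly_neq0_itv (nderivn_neq0 hm).
have tI : t \in `[-1, 1] by rewrite in_itv /=; case/andP: ht => /ltW -> /ltW ->.
have hth : 0 <= acos t <= pi.
  by rewrite acos_ge0 ?acos_lepi //; case/andP: ht => /ltW -> /ltW ->.
have := Pg _ phi hth; rewrite (bigD1 i0) //= big1 ?addr0 => [|i ii0].
  rewrite -/m tm mulr1 sh_polarE // acosK // => h; apply/eqP; apply: contraT => M0.
  have s0 : sin (acos t) != 0.
    rewrite sin_acos; last by move: tI; rewrite in_itv.
    by rewrite gt_eqF // sqrtr_gt0; nra.
  exfalso; move/eqP: h; apply/negP.
  by apply: mulf_neq0 => //; apply: mulf_neq0 => //; apply: mulf_neq0;
    [exact: sh_const_neq0 | apply: mulf_neq0 => //; apply: expf_neq0].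
have nm : order_of i != m by rewrite (inj_eq (@order_of_inj l)).
have [e|e] := eqVneq `|order_of i|%N `|m|%N; last by rewrite gn ?mul0r ?abs_order_of.
by rewrite tn ?mulr0.
Qed.

End Components.

(** * Existence of Wigner matrices *)

Section Existence.
Variable R : realType.
Implicit Types (l : nat) (r : 'cV[R]_3) (theta phi : R).
Local Notation C := (complex R).
Local Notation I := (Complex 0 1 : C).

Definition null_form r : {poly C} :=
  trinom (Complex (cx r) (cz r)) ((cy r)%:C%C *+ 2) (Complex (- cx r) (cz r)).

Lemma de_moivre (x phi : R) m :
  Complex (x * cos phi) (x * sin phi) ^+ m =
  (x ^+ m)%:C%C * Complex (cos (m%:R * phi)) (sin (m%:R * phi)).
Proof.
elim: m => [|m IH]; first by rewrite !expr0 mul0r cos0 sin0 mul1r.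
rewrite exprS IH -natr1 mulrDl mul1r cosD sinD exprS.
by apply/eqP; rewrite eq_complex /=; apply/andP; split; apply/eqP; ring.
Qed.

Lemma sqrI : I ^+ 2 = -1.
Proof. by apply/eqP; rewrite eq_complex /=; apply/andP; split; apply/eqP; ring. Qed.

Lemma I_neq0 : I != 0.
Proof. by rewrite eq_complex /= oner_eq0 andbF. Qed.

Lemma null_form_coef_hi l m theta phi : (m <= l)%N ->
  (null_form (sphere_point theta phi) ^+ l)`_(l + m) =
  I ^+ m * (sin theta ^+ m * (('X^2 - 1) ^+ l)^`N(l + m).[cos theta])%:C%C
   * Complex (cos (m%:R * phi)) (sin (m%:R * phi)).
Proof.
move=> hm; rewrite /null_form trinom_coef_hi //.
- rewrite /cx /cy /cz !mxE /=.
  have -> : Complex (- (sin theta * sin phi)) (sin theta * cos phi) =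
     I * Complex (sin theta * cos phi) (sin theta * sin phi).
    by apply/eqP; rewrite eq_complex /=; apply/andP; split; apply/eqP; ring.
  have -> : ('X^2 - 1 : {poly C}) ^+ l = map_poly (real_complex R) (('X^2 - 1) ^+ l).
    by rewrite rmorphXn rmorphB rmorphXn rmorph1 /= map_polyX.
  rewrite nderivn_map horner_map exprMn de_moivre rmorphM /=; ring.
- have h := S2_sphere_point theta phi; rewrite /S2 in h.
  by rewrite expr2; apply/eqP; rewrite eq_complex /=; apply/andP; split; apply/eqP; nra.
- by move=> [h1 h2]; apply/eqP; rewrite eq_complex /= h2 -[cx _]opprK h1 oppr0 eqxx.
Qed.

Lemma null_form_coef_lo l m theta phi : (m <= l)%N ->
  (null_form (sphere_point theta phi) ^+ l)`_(l - m) =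
  I ^+ m * (sin theta ^+ m * (('X^2 - 1) ^+ l)^`N(l + m).[cos theta])%:C%C
   * Complex (cos (m%:R * phi)) (- sin (m%:R * phi)).
Proof.
move=> hm; rewrite /null_form trinom_coef_lo //.
- rewrite /cx /cy /cz !mxE /=.
  have -> : Complex (sin theta * sin phi) (sin theta * cos phi) =
     I * Complex (sin theta * cos (- phi)) (sin theta * sin (- phi)).
    by rewrite cosN sinN; apply/eqP; rewrite eq_complex /=; apply/andP; split; apply/eqP; ring.
  have -> : ('X^2 - 1 : {poly C}) ^+ l = map_poly (real_complex R) (('X^2 - 1) ^+ l).
    by rewrite rmorphXn rmorphB rmorphXn rmorph1 /= map_polyX.
  rewrite nderivn_map horner_map exprMn de_moivre rmorphM /= mulrN cosN sinN; ring.
- have h := S2_sphere_point theta phi; rewrite /S2 in h.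
  by rewrite expr2; apply/eqP; rewrite eq_complex /=; apply/andP; split; apply/eqP; nra.
- by move=> [h1 h2]; apply/eqP; rewrite eq_complex /= h2 h1 oppr0 eqxx.
Qed.

(** Up to a real factor depending on l, m and the colatitude, this is exp(i m phi); for m = 0 the
    imaginary part is sin 0, not Y_0 again. *)
Definition harm_pair l (m : nat) (r : 'cV[R]_3) : C :=
  Complex (cmp (sph_harm l r) (- m%:Z)) (if m == 0%N then 0 else cmp (sph_harm l r) m).

Lemma harm_pairE l m theta phi : (m <= l)%N -> 0 <= theta <= pi ->
  harm_pair l m (sphere_point theta phi) =
  (sh_const R l m * (sin theta ^+ m * (('X^2 - 1) ^+ l)^`N(l + m).[cos theta]))%:C%C
   * Complex (cos (m%:R * phi)) (sin (m%:R * phi)).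
Proof.
move=> hm ht; rewrite /harm_pair !cmp_sph_harm ?abszN // !sh_polarE // sh_constN abszN /=.
apply/eqP; rewrite eq_complex /= /trig; apply/andP; split; apply/eqP.
  rewrite (_ : (0 < - m%:Z) = false) ?mulrNz ?mulNr ?cosN; last by lia.
  by rewrite mul0r subr0.
case: m hm => [|m] hm /=; first by rewrite !mul0r sin0 mulr0 addr0.
by rewrite mul0r addr0.
Qed.

Lemma real_complexVKM (k x : R) (w z : C) : k != 0 ->
  w * (k^-1)%:C%C * ((k * x)%:C%C * z) = w * x%:C%C * z.
Proof.
move=> k0; rewrite [(k * x)%:C%C]rmorphM /= -!mulrA; congr (_ * _).
by rewrite !mulrA -[_%:C%C * k%:C%C]rmorphM /= mulVf // mul1r.
Qed.

Lemma null_form_hi l m r : S2 r -> (m <= l)%N ->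
  (null_form r ^+ l)`_(l + m) = I ^+ m * (sh_const R l m)^-1%:C%C * harm_pair l m r.
Proof.
move=> /sphereP [theta [phi [ht ->]]] hm.
by rewrite null_form_coef_hi // harm_pairE // real_complexVKM // sh_const_neq0.
Qed.

Lemma null_form_lo l m r : S2 r -> (m <= l)%N ->
  (null_form r ^+ l)`_(l - m) = I ^+ m * (sh_const R l m)^-1%:C%C * conjc (harm_pair l m r).
Proof.
move=> /sphereP [theta [phi [ht ->]]] hm.
have conjM (x : R) (z : C) : conjc (x%:C%C * z) = x%:C%C * conjc z.
  by case: z => a b; apply/eqP; rewrite eq_complex /=; apply/andP; split; apply/eqP; ring.
rewrite null_form_coef_lo // harm_pairE // conjM.
by rewrite real_complexVKM // sh_const_neq0.
Qed.

Definition in_span l (f : 'cV[R]_3 -> R) :=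
  exists c : 'rV[R]_(l.*2.+1), forall r, S2 r -> f r = (c *m sph_harm l r) 0 0.

(** Real and imaginary parts are kept apart because the Wigner matrix sought is real; the notion is
    still stable under complex scalars and conjugation. *)
Definition in_cspan l (f : 'cV[R]_3 -> C) :=
  in_span l (fun r => complex.Re (f r)) /\ in_span l (fun r => complex.Im (f r)).

Lemma in_span_ext l f g : (forall r, S2 r -> f r = g r) -> in_span l f -> in_span l g.
Proof. by move=> h [c hc]; exists c => r hr; rewrite -h // hc. Qed.

Lemma in_span0 l : in_span l (fun=> 0).
Proof. by exists 0 => r _; rewrite mul0mx mxE. Qed.

Lemma in_span_lin l (x y : R) f g : in_span l f -> in_span l g ->
  in_span l (fun r => x * f r + y * g r).
Proof.
move=> [c hc] [d hd]; exists (x *: c + y *: d) => r hr.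
by rewrite mulmxDl -!scalemxAl !mxE hc // hd // !mxE.
Qed.

Lemma in_span_cmp l m : in_span l (fun r => cmp (sph_harm l r) m).
Proof. by exists (delta_mx 0 (pos_of l m)) => r _; rewrite -rowE [RHS]mxE. Qed.

Lemma in_cspan_ext l f g : (forall r, S2 r -> f r = g r) -> in_cspan l f -> in_cspan l g.
Proof.
by move=> h [h1 h2]; split; [apply: in_span_ext h1 | apply: in_span_ext h2] => r hr;
  rewrite h.
Qed.

Lemma in_cspan0 l : in_cspan l (fun=> 0).
Proof. by split; exact: in_span0. Qed.

Lemma in_cspanD l f g : in_cspan l f -> in_cspan l g -> in_cspan l (fun r => f r + g r).
Proof.
move=> [f1 f2] [g1 g2]; split.
  apply: in_span_ext (in_span_lin 1 1 f1 g1) => r _.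
  by case: (f r) (g r) => a b [c d] /=; rewrite !mul1r.
apply: in_span_ext (in_span_lin 1 1 f2 g2) => r _.
by case: (f r) (g r) => a b [c d] /=; rewrite !mul1r.
Qed.

Lemma in_cspanZ l z f : in_cspan l f -> in_cspan l (fun r => z * f r).
Proof.
case: z => x y [f1 f2]; split.
  apply: in_span_ext (in_span_lin x (- y) f1 f2) => r _.
  by case: (f r) => a b /=; rewrite mulNr.
apply: in_span_ext (in_span_lin x y f2 f1) => r _.
by case: (f r) => a b /=; ring.
Qed.

Lemma in_cspan_sum l n (F : 'I_n -> 'cV[R]_3 -> C) :
  (forall i, in_cspan l (F i)) -> in_cspan l (fun r => \sum_i F i r).
Proof.
move=> h; elim: n F h => [|n IH] F h.
  by apply: in_cspan_ext (in_cspan0 l) => r _; rewrite big_ord0.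
apply: in_cspan_ext (in_cspanD (h ord0) (IH _ (fun i => h (lift ord0 i)))) => r _.
by rewrite big_ord_recl.
Qed.

Lemma in_cspan_harm_pair l m : in_cspan l (harm_pair l m).
Proof.
split; first exact: in_span_cmp.
by rewrite /harm_pair /=; case: eqP => _; [exact: in_span0 | exact: in_span_cmp].
Qed.

Lemma in_cspan_conj l f : in_cspan l f -> in_cspan l (fun r => conjc (f r)).
Proof.
move=> [f1 f2]; split.
  by apply: in_span_ext f1 => r _; case: (f r).
apply: in_span_ext (in_span_lin 0 (-1) f1 f2) => r _.
by case: (f r) => a b /=; rewrite mul0r add0r mulN1r.
Qed.

Lemma in_cspan_null_form l d : (d <= l.*2)%N ->
  in_cspan l (fun r => (null_form r ^+ l)`_d).
Proof.
move=> hd; have [h|h] := leqP l d.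
  apply: in_cspan_ext (in_cspanZ _ (in_cspan_harm_pair l (d - l))) => r hr.
  rewrite -[in RHS](subnKC h); symmetry; apply: null_form_hi => //; lia.
apply: in_cspan_ext (in_cspanZ _ (in_cspan_conj (in_cspan_harm_pair l (l - d)))) => r hr.
rewrite -[in RHS](subKn (ltnW h)); symmetry; apply: null_form_lo => //; lia.
Qed.

(** The standard rational parametrisation of the isotropic cone x^2 + y^2 + z^2 = 0. *)
Definition null_row : 'rV[{poly C}]_3 :=
  \row_j (if j == 0 then 1 - 'X^2 else if j == 1 then 'X *+ 2 else I *: (1 + 'X^2)).

Lemma null_row_isotropic : null_row *m null_row^T = 0.
Proof.
apply/matrixP => i j; rewrite !ord1 !mxE !big_ord_recl big_ord0 !mxE /=.
rewrite -!mul_polyC.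
have e : (I%:P : {poly C}) ^+ 2 = -1 by rewrite -polyC_exp sqrI polyCN.
transitivity ((1 - 'X^2) ^+ 2 + 4 * 'X^2 + I%:P ^+ 2 * (1 + 'X^2) ^+ 2 : {poly C}); first by ring.
by rewrite e; ring.
Qed.

Lemma cxyzE (S : Type) (f : R -> S) r :
  [/\ map_mx f r 0 0 = f (cx r), map_mx f r 1 0 = f (cy r) & map_mx f r 2 0 = f (cz r)].
Proof. by rewrite !mxE. Qed.

Lemma sum3E (V : nmodType) (F : 'I_3 -> V) : \sum_i F i = F 0 + F 1 + F 2.
Proof.
rewrite ?big_ord_recl big_ord0 addr0 addrA.
by congr (F _ + F _ + F _); apply: val_inj.
Qed.

Definition polyRC (x : R) : {poly C} := (x%:C%C)%:P.

Lemma polyRC_mulmx (m n k : nat) (X : 'M[R]_(m, n)) (Y : 'M[R]_(n, k)) :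
  map_mx polyRC (X *m Y) = map_mx polyRC X *m map_mx polyRC Y.
Proof. exact: (map_mxM (polyC \o real_complex R)). Qed.

Lemma polyC_complex x y : (Complex x y)%:P = polyRC x + I%:P * polyRC y.
Proof.
rewrite /polyRC -polyCM -polyCD; congr (_%:P).
by apply/eqP; rewrite eq_complex /=; apply/andP; split; apply/eqP; ring.
Qed.

Lemma polyRCN x : polyRC (- x) = - polyRC x.
Proof. by rewrite /polyRC rmorphN polyCN. Qed.

Lemma null_form_polyE r : null_form r = polyRC (cx r) + I%:P * polyRC (cz r) +
  polyRC (cy r) *+ 2 * 'X + (- polyRC (cx r) + I%:P * polyRC (cz r)) * 'X^2.
Proof.
rewrite /null_form /trinom -[_ *: 'X]mul_polyC -[_ *: 'X^2]mul_polyC.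
rewrite (polyC_complex (cx r)) (polyC_complex (- cx r)) polyRCN polyCMn.
reflexivity.
Qed.

Lemma null_formE r : null_form r = (null_row *m map_mx polyRC r) 0 0.
Proof.
have [e0 e1 e2] := cxyzE polyRC r.
rewrite mxE sum3E e0 e1 e2 !mxE /= null_form_polyE -[I *: _]mul_polyC.
move: (I%:P) (polyRC (cx r)) (polyRC (cy r)) (polyRC (cz r)) => i x y z.
by ring.
Qed.

Lemma null_form_rot l (A : 'M[R]_3) : A^T *m A = 1%:M ->
  exists mu : nat -> {poly C}, forall r, S2 r ->
    null_form (A *m r) ^+ l = \sum_(d < l.*2.+1) (null_form r ^+ l)`_d *: mu d.
Proof.
move=> hA; have hA' := mulmx1C hA.
pose n := null_row *m map_mx polyRC A.
have n_iso : n *m n^T = 0.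
  have AT : (map_mx polyRC A)^T = map_mx polyRC A^T by apply/matrixP => i j; rewrite !mxE.
  rewrite /n trmx_mul -mulmxA [map_mx _ A *m _]mulmxA AT -polyRC_mulmx hA'.
  rewrite (map_mx1 (polyC \o real_complex R)) mul1mx.
  exact: null_row_isotropic.
have n2 : n 0 0 ^+ 2 + n 0 1 ^+ 2 + n 0 2 ^+ 2 = 0.
  have := congr1 (fun M : 'rV[{poly C}]_1 => M 0 0) n_iso.
  by rewrite [RHS]mxE [LHS]mxE sum3E ![n^T _ _]mxE.
(* The polynomials p, q, s solve n = (s - p, 2q, i(s + p)), the shape of [null_row] with s = 1, q =
   X, p = X^2. Isotropy of n then reads q^2 = p s. *)
pose h : {poly C} := (2^-1)%:P.
pose p := h * (- I%:P * n 0 2 - n 0 0).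
pose q := h * n 0 1.
pose s := h * (- I%:P * n 0 2 + n 0 0).
have e : (I%:P : {poly C}) ^+ 2 = -1 by rewrite -polyC_exp sqrI polyCN.
have e2 : h * 2 = 1.
  by rewrite -polyC_natr -polyCM mulVf // pnatr_eq0.
have hq : q ^+ 2 = p * s.
  rewrite /q /p /s.
  transitivity (h ^+ 2 * (I%:P ^+ 2 * n 0 2 ^+ 2 - n 0 0 ^+ 2)); last by ring.
  rewrite e exprMn; congr (_ * _); apply/eqP; rewrite -subr_eq0 -[X in _ == X]n2.
  by apply/eqP; ring.
exists (cone_mono p q s l) => r hr; rewrite -trinom_cone //; congr (_ ^+ _).
have [e0 e1 e3] := cxyzE polyRC r.
rewrite null_formE polyRC_mulmx mulmxA -/n mxE sum3E e0 e1 e3.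
transitivity ((polyRC (cx r) + I%:P * polyRC (cz r)) * s + polyRC (cy r) *+ 2 * q
   + (- polyRC (cx r) + I%:P * polyRC (cz r)) * p); last first.
  rewrite -!mul_polyC (polyC_complex (cx r)) (polyC_complex (- cx r)) polyRCN polyCMn.
  reflexivity.
rewrite /p /q /s.
move: (polyRC (cx r)) (polyRC (cy r)) (polyRC (cz r)) => X Y Z.
clearbody h n; move: (I%:P) e (n 0 0) (n 0 1) (n 0 2) => i e a b c.
transitivity (h * 2 * (a * X + b * Y - i ^+ 2 * c * Z)); last by ring.
by rewrite e e2; ring.
Qed.

(** Read off the coefficient of degree l + m in [null_form_rot]: on the rotated side it is a nonzero
    multiple of the pair, on the other a combination of coefficients lying in the span. *)
Lemma in_cspan_harm_pair_rot l m (A : 'M[R]_3) : A^T *m A = 1%:M -> (m <= l)%N ->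
  (forall r, S2 r -> S2 (A *m r)) -> in_cspan l (fun r => harm_pair l m (A *m r)).
Proof.
move=> hA hm hS; have [mu hmu] := null_form_rot l hA.
apply: (@in_cspan_ext l (fun r => (I ^+ m * (sh_const R l m)^-1%:C%C)^-1 *
    \sum_(d < l.*2.+1) (mu d)`_(l + m) * (null_form r ^+ l)`_d)).
  move=> r hr.
  have -> : \sum_(d < l.*2.+1) (mu d)`_(l + m) * (null_form r ^+ l)`_d =
      (null_form (A *m r) ^+ l)`_(l + m).
    by rewrite hmu // coef_sum; apply: eq_bigr => d _; rewrite coefZ mulrC.
  rewrite null_form_hi //; last exact: hS.
  rewrite mulKf // mulf_neq0 ?expf_neq0 ?I_neq0 //.
  rewrite fmorph_eq0 invr_eq0; exact: sh_const_neq0.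
apply: in_cspanZ; apply: in_cspan_sum => d; apply: in_cspanZ.
by apply: in_cspan_null_form; rewrite -ltnS.
Qed.

Lemma S2_trmx r : S2 r <-> r^T *m r = 1%:M.
Proof.
have e : r^T *m r = (cx r ^+ 2 + cy r ^+ 2 + cz r ^+ 2)%:M.
  apply/matrixP => i j; rewrite !ord1 !mxE !big_ord_recl big_ord0 !mxE /= mulr1n.
  rewrite addr0 addrA -!expr2.
  by congr (r _ _ ^+ _ + r _ _ ^+ _ + r _ _ ^+ _); apply: val_inj.
rewrite e /S2; split => [->//|/(congr1 (fun M : 'rV[R]_1 => M 0 0))].
by rewrite !mxE !mulr1n.
Qed.

Lemma S2_rot (A : 'M[R]_3) r : A^T *m A = 1%:M -> S2 r -> S2 (A *m r).
Proof.
move=> hA /S2_trmx hr; apply/S2_trmx.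
by rewrite trmx_mul -mulmxA [A^T *m _]mulmxA hA mul1mx.
Qed.

Lemma wigner_exists l (A : 'M[R]_3) : A^T *m A = 1%:M ->
  exists D : 'M[R]_(l.*2.+1), forall r, S2 r -> sph_harm l (A *m r) = D *m sph_harm l r.
Proof.
move=> hA.
have H (i : 'I_l.*2.+1) : in_span l (fun r => sph_harm l (A *m r) i 0).
  have hi := abs_order_of i.
  have [h1 h2] := in_cspan_harm_pair_rot hA hi (fun r => @S2_rot A r hA).
  (* Nonpositive orders are real parts of the pair for |m|, positive ones imaginary parts. *)
  have [hm|hm] := leP (order_of i) 0.
    apply: in_span_ext h1 => r _; rewrite /harm_pair /= cmpE; congr (cmp _ _); lia.
  apply: in_span_ext h2 => r _; rewrite /harm_pair /= ifF; last by lia.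
  by rewrite cmpE; congr (cmp _ _); lia.
have [c hc] := choice H.
exists (\matrix_i c i) => r hr; apply/colP => i.
by rewrite hc // !mxE; apply: eq_bigr => j _; rewrite !mxE.
Qed.

Lemma wignerE l (A : 'M[R]_3) r : SO3 A -> S2 r ->
  sph_harm l (A *m r) = wigner l A *m sph_harm l r.
Proof.
move=> [hA _] hr; have [D hD] := wigner_exists l hA.
rewrite /wigner; case: xgetP => [D' _ /(_ r hr)//|/(_ D)]; by [].
Qed.

Lemma wigner_unique l (A : 'M[R]_3) D : SO3 A ->
  (forall r, S2 r -> sph_harm l (A *m r) = D *m sph_harm l r) -> wigner l A = D.
Proof.
move=> hA hD; apply/eqP; rewrite -subr_eq0; apply/eqP; apply: sph_harm_free => r hr.
by rewrite mulmxBl -wignerE // hD // subrr.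
Qed.

Lemma SO3_invmx (A : 'M[R]_3) : SO3 A -> invmx A *m A = 1%:M /\ SO3 (invmx A).
Proof.
move=> [hA dA]; have uA : A \in unitmx by rewrite unitmxE dA unitr1.
have iA : invmx A = A^T by rewrite -[LHS]mul1mx -hA mulmxK.
by split; [exact: mulVmx | rewrite iA; split; rewrite ?trmxK ?det_tr // mulmx1C].
Qed.

Lemma wigner_invmx l (A : 'M[R]_3) : SO3 A -> wigner l (invmx A) *m wigner l A = 1%:M.
Proof.
move=> hA; have [AV hAV] := SO3_invmx hA.
apply/eqP; rewrite -subr_eq0; apply/eqP; apply: sph_harm_free => r hr.
rewrite mulmxBl mul1mx -mulmxA -wignerE // -wignerE ?mulmxA ?AV ?mul1mx ?subrr //.
by apply: S2_rot => //; case: hA.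
Qed.

End Existence.

(** * The tensor product with the harmonic at the pole *)

Section Polar.
Variable R : realType.
Implicit Types (l : nat) (m : int) (al : R).

Lemma legendre_at1 l : (legendre R l).[1] = 1.
Proof.
rewrite /legendre hornerZ nderivn_def hornerMn -trinom_taylor.
(* The coefficient of X^l in X^l (2 + X)^l is 2^l, which cancels the Rodrigues normalisation. *)
have -> : trinom (1 ^+ 2 - 1) (1 *+ 2) 1 = 'X * ((1 *+ 2)%:P + 'X) :> {poly R}.
  by rewrite /trinom expr1n subrr add0r scale1r -mul_polyC; ring.
rewrite exprMn coefXnM ltnn subnn -horner_coef0 horner_exp hornerD hornerC hornerX addr0.
by rewrite -[2 ^+ l *+ _]mulr_natr mulVf // mulf_neq0 ?expf_neq0 ?pnatr_eq0 //.
Qed.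

Lemma sph_harm_pole l : sph_harm l (pole R) = ebasis R l 0.
Proof.
have -> : pole R = sphere_point 0 0.
  apply/colP => i; rewrite !mxE eqxx andbT sin0 cos0 !mul0r.
  by case: i => [[|[|[|]]]].
apply: eq_cmp => m hm; rewrite cmp_sph_harm ?lexx ?pi_ge0 //.
rewrite /cmp mxE eqxx andbT /trig !mulr0 cos0 sin0.
rewrite /sh_polar /assoc_legendre cos0 expr1n subrr sqrtr0.
have [->|m0] := eqVneq m 0.
  by rewrite eqxx /= expr0 legendre_at1 /sh_norm eqxx !mul1r.
rewrite expr0n absz_eq0 (negbTE m0) mul0r mulr0 mul0r.
rewrite (_ : (_ == _) = false) //; apply/negbTE; apply: contra m0 => /eqP h.
by rewrite -(pos_ofK hm) h pos_ofK.
Qed.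

Definition roty al : 'M[R]_3 := \matrix_(i, j)
  if i == 0 then (if j == 0 then cos al else if j == 1 then 0 else sin al)
  else if i == 1 then (j == 1)%:R
  else if j == 0 then - sin al else if j == 1 then 0 else cos al.

Lemma SO3_roty al : SO3 (roty al).
Proof.
have h := cos2Dsin2 al; split.
  apply/matrixP => i j; rewrite !mxE sum3E !mxE /=.
  by case: i => [[|[|[|]]]] //= ?; case: j => [[|[|[|]]]] //= ?; rewrite ?mulr1n ?mulr0n; nra.
rewrite (expand_det_row _ 1) sum3E !mxE /= /cofactor !(mul0r, add0r, addr0) mul1r.
rewrite (expand_det_row _ ord0) !big_ord_recl big_ord0 /cofactor !det_mx11 !mxE /=.
by rewrite -[RHS]h /bump /= modn_small // addn0 add0n !expr0 expr1 sqrrN expr1n; ring.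
Qed.

Lemma roty_sphere_point al theta phi :
  roty al *m sphere_point theta phi = sphere_point theta (phi + al).
Proof.
apply/colP => i; rewrite !mxE sum3E !mxE /= sinD cosD.
by case: i => [[|[|[|]]]] //= ?; ring.
Qed.

(** Plane rotations by m al on the pairs (m, -m), from the addition formulas. At order 0 the two
    deltas coincide, but sin 0 = 0 leaves the entry 1. *)
Definition wigner_roty l al : 'M[R]_(l.*2.+1) := \matrix_(i, j)
  (cos ((order_of i)%:~R * al) * (j == i)%:R
   + sin ((order_of i)%:~R * al) * (j == pos_of l (- order_of i))%:R).

Lemma cmp_wigner_roty_mulmx l al (v : 'Vec[R]_l) m : (`|m| <= l)%N ->
  cmp (wigner_roty l al *m v) m =
  cos (m%:~R * al) * cmp v m + sin (m%:~R * al) * cmp v (- m).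
Proof.
move=> hm; rewrite {1}/cmp mxE.
under eq_bigr do rewrite mxE mulrDl -!mulrA.
rewrite big_split /= -!mulr_sumr pos_ofK //.
have pick k : \sum_(j < l.*2.+1) (j == k)%:R * v j 0 = v k 0.
  by rewrite (bigD1 k) //= eqxx mul1r big1 ?addr0 // => j /negbTE ->; rewrite mul0r.
by rewrite !pick.
Qed.

Lemma wigner_rotyE l al : wigner l (roty al) = wigner_roty l al.
Proof.
apply: wigner_unique; first exact: SO3_roty.
move=> _ /sphereP [theta [phi [ht ->]]]; rewrite roty_sphere_point.
apply: eq_cmp => m hm; rewrite cmp_wigner_roty_mulmx // !cmp_sph_harm ?abszN //.
have -> : sh_polar l (- m) theta = sh_polar l m theta.
  by rewrite !sh_polarE // sh_constN abszN.
rewrite mulrCA [X in _ = _ + X]mulrCA -mulrDr; congr (_ * _).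
rewrite /trig mulrDr rmorphN mulNr cosN sinN.
have [m0|m0] := ltrP 0 m.
  by rewrite (_ : 0 < - m = false) ?sinD; [ring | lia].
have [->|m1] := eqVneq m 0; first by rewrite !mul0r oppr0 ltxx addr0 cos0 sin0; ring.
by rewrite (_ : 0 < - m) ?cosD; [ring | lia].
Qed.

End Polar.

(** * Clebsch-Gordan coefficients with filter order 0 *)

Section Diagonal.
Variables (R : realType) (li lf lo : nat).
Variable T : {bilinear 'Vec[R]_li -> 'Vec[R]_lf -> 'Vec[R]_lo}.
Hypothesis hT : tensor_product_axiom T.
Implicit Types (m n : int) (al : R).

Local Notation N := (fun mo mi => clebsch_gordan T mo mi 0).

Lemma cmp_ebasis l m n : (`|m| <= l)%N -> (`|n| <= l)%N ->
  cmp (ebasis R l m) n = (m == n)%:R.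
Proof.
move=> hm hn; rewrite /cmp mxE eqxx andbT; congr (nat_of_bool _)%:R.
by apply/eqP/eqP => [h|->//]; rewrite -(pos_ofK hm) -(pos_ofK hn) h.
Qed.

Lemma wigner_roty_ebasis l al m : (`|m| <= l)%N ->
  wigner_roty l al *m ebasis R l m =
  cos (m%:~R * al) *: ebasis R l m - sin (m%:~R * al) *: ebasis R l (- m).
Proof.
move=> hm; apply: eq_cmp => n hn; rewrite cmp_wigner_roty_mulmx //.
have -> (a b : R) (u v : 'Vec[R]_l) : cmp (a *: u - b *: v) n = a * cmp u n - b * cmp v n.
  by rewrite /cmp !mxE.
rewrite !cmp_ebasis ?abszN //.
rewrite eqr_oppLR; congr (_ + _); first by case: eqVneq => [->|]; rewrite ?mulr0.
by case: eqVneq => [->|]; rewrite ?mulr0 ?oppr0 // rmorphN mulNr sinN mulNr opprK.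
Qed.

(** Equivariance under a rotation about the y-axis, which fixes e_0, read entrywise. *)
Lemma clebsch_gordan_roty al mo mi : (`|mo| <= lo)%N -> (`|mi| <= li)%N ->
  cos (mo%:~R * al) * N mo mi + sin (mo%:~R * al) * N (- mo) mi =
  cos (mi%:~R * al) * N mo mi - sin (mi%:~R * al) * N mo (- mi).
Proof.
move=> ho hi; have := hT.2 _ (SO3_roty al) (ebasis R li mi) (ebasis R lf 0).
rewrite !wigner_rotyE !wigner_roty_ebasis // !mul0r cos0 sin0 scale0r subr0 scale1r.
move/(congr1 (fun v => cmp v mo)); rewrite cmp_wigner_roty_mulmx // => ->.
by rewrite linearBl !linearZl_LR /= /cmp !mxE.
Qed.

(** Adding the relations for al and -al removes the sines and leaves (cos(m_o al) - cos(m_i al)) N =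
    0; the chosen al makes the factor nonzero. *)
Lemma clebsch_gordan_offdiag mo mi : (`|mo| <= lo)%N -> (`|mi| <= li)%N ->
  `|mo|%N != `|mi|%N -> N mo mi = 0.
Proof.
move=> ho hi hn; set al : R := pi / (lo + li).+1%:R.
have e1 := clebsch_gordan_roty al ho hi; have e2 := clebsch_gordan_roty (- al) ho hi.
rewrite !mulrN !cosN !sinN !mulNr opprK in e2.
have ho' : (`|mo| <= lo + li)%N by lia.
have hi' : (`|mi| <= lo + li)%N by lia.
have := @cos_order_neq R _ _ _ ho' hi' hn; rewrite -/al -subr_eq0 => h.
apply: (mulfI h); rewrite mulr0 mulrBl.
move: e1 e2; lra.
Qed.

Lemma clebsch_gordan_sym m : m != 0 -> (`|m| <= lo)%N -> (`|m| <= li)%N ->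
  N (- m) m = - N m (- m) /\ N (- m) (- m) = N m m.
Proof.
move=> m0 ho hi.
have mi0 : (m%:~R : R) != 0 by rewrite intr_eq0.
(* With m al = pi/2 the block commutes with a quarter turn, so it has the form of a complex
   multiplication. *)
set al : R := pi / 2 / m%:~R.
have h : m%:~R * al = pi / 2 by rewrite mulrC divfK.
have e1 := clebsch_gordan_roty al ho hi.
have hi' : (`|- m| <= li)%N by rewrite abszN.
have e2 := clebsch_gordan_roty al ho hi'.
rewrite rmorphN mulNr cosN sinN opprK h cos_pihalf sin_pihalf in e2.
rewrite h cos_pihalf sin_pihalf in e1.
by split; [move: e1 | move: e2]; lra.
Qed.

Lemma tensor_axis (x : 'Vec[R]_li) m : (`|m| <= lo)%N ->
  cmp (T x (ebasis R lf 0)) m = \sum_(i < li.*2.+1) cmp x (order_of i) * N m (order_of i).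
Proof.
move=> hm; rewrite {1}(matrix_sum_delta x) linear_sumlz /cmp summxE.
apply: eq_bigr => i _; rewrite big_ord1 linearZl_LR mxE /clebsch_gordan /cmp /ebasis.
by rewrite order_ofK.
Qed.

Lemma tensor_axis_so2 (x : 'Vec[R]_li) m : (`|m| <= lo)%N ->
  cmp (T x (ebasis R lf 0)) m =
  if (li < `|m|)%N then 0 else if m == 0 then N 0 0 * cmp x 0
  else N m m * cmp x m + N m (- m) * cmp x (- m).
Proof.
move=> hm; rewrite tensor_axis //; case: ltnP => hi.
  rewrite big1 // => i _; rewrite clebsch_gordan_offdiag ?mulr0 ?abs_order_of //.
  by have := abs_order_of i; lia.
have off (i : 'I_li.*2.+1) : i != pos_of li m -> i != pos_of li (- m) ->
    cmp x (order_of i) * N m (order_of i) = 0.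
  move=> h1 h2; rewrite clebsch_gordan_offdiag ?mulr0 ?abs_order_of //.
  apply/eqP => e; have [e1|e1] : order_of i = m \/ order_of i = - m by lia.
    by move: h1; rewrite -e1 order_ofK eqxx.
  by move: h2; rewrite -e1 order_ofK eqxx.
have [m0|m0] := eqVneq m 0.
  rewrite (bigD1 (pos_of li 0)) //= big1 ?addr0 => [|i hi0].
    by rewrite pos_ofK // m0 mulrC.
  by rewrite off // m0 ?oppr0.
rewrite (bigD1 (pos_of li m)) //= (bigD1 (pos_of li (- m))) /=; last first.
  by apply/eqP => /(congr1 (@order_of li)); rewrite !pos_ofK ?abszN //; lia.
rewrite big1 ?addr0 => [|i /andP [h1 h2]]; last exact: off.
by rewrite !pos_ofK ?abszN // ![cmp x _ * _]mulrC.
Qed.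

End Diagonal.

(** The filter coefficients [cg_diag] record only the column of the positive order |m| in each
    block; [clebsch_gordan_sym] supplies the other column and the minus sign of the 2 x 2 matrix. *)
Lemma so2_convE (R : realType) (T : forall li lf lo : nat,
    {bilinear 'Vec[R]_li -> 'Vec[R]_lf -> 'Vec[R]_lo}) h (li lo : nat) (x : 'Vec[R]_li) :
  (forall lf, admissible li lf lo -> tensor_product_axiom (T li lf lo)) ->
  so2_conv T h lo x =
  \sum_(`|li%:Z - lo%:Z|%N <= lf < (li + lo).+1) T li lf lo x (h li lf lo *: ebasis R lf 0).
Proof.
move=> hT; apply: eq_cmp => m hm; rewrite cmp_vec //.
have -> (s : seq nat) (F : nat -> 'Vec[R]_lo) :
    cmp (\sum_(lf <- s) F lf) m = \sum_(lf <- s) cmp (F lf) m by rewrite /cmp summxE.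
pose H (m n : int) := \sum_(`|li%:Z - lo%:Z|%N <= lf < (li + lo).+1)
  h li lf lo * clebsch_gordan (T li lf lo) m n 0.
transitivity (if (li < `|m|)%N then 0 else if m == 0 then H 0 0 * cmp x 0
  else H m m * cmp x m + H m (- m) * cmp x (- m)); last first.
  transitivity (\sum_(`|li%:Z - lo%:Z|%N <= lf < (li + lo).+1) h li lf lo *
    (if (li < `|m|)%N then 0 else if m == 0 then clebsch_gordan (T li lf lo) 0 0 0 * cmp x 0
     else clebsch_gordan (T li lf lo) m m 0 * cmp x m
        + clebsch_gordan (T li lf lo) m (- m) 0 * cmp x (- m))).
    case: ifP => _; first by rewrite big1 // => lf _; rewrite mulr0.
    case: ifP => _; rewrite /H !mulr_suml -?big_split /=;
      by apply: eq_bigr => lf _; rewrite ?mulrDr !mulrA.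
  (* Keeping the summation range gives [hlf], which is [admissible] by conversion and so provides
     equivariance of [T li lf lo]. *)
  rewrite !big_nat; apply: eq_bigr => lf hlf.
  have hTl := hT lf hlf.
  by rewrite linearZr_LR /= -(tensor_axis_so2 hTl) // /cmp !mxE.
have -> : (minn li lo < `|m|)%N = (li < `|m|)%N by lia.
case: ltnP => // hi; case: eqVneq => [_|m0].
  by congr (_ * _); rewrite /htilde /cg_diag lexx.
have sym lf : (`|li%:Z - lo%:Z|%N <= lf < (li + lo).+1)%N ->
    clebsch_gordan (T li lf lo) (- m) m 0 = - clebsch_gordan (T li lf lo) m (- m) 0 /\
    clebsch_gordan (T li lf lo) (- m) (- m) 0 = clebsch_gordan (T li lf lo) m m 0.
  by move=> hlf; apply: clebsch_gordan_sym => //; exact: hT.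
case: ifP => mp.
  have -> : htilde T h li lo m = H m m by rewrite /htilde /cg_diag (ltW mp).
  have -> : htilde T h li lo (- m) = - H m (- m).
    rewrite /htilde /H -sumrN !big_nat; apply: eq_bigr => lf /sym [e _].
    by rewrite /cg_diag oppr_ge0 leNgt mp /= opprK e mulrN.
  by rewrite mulNr opprK.
have mn : m < 0 by lia.
have -> : htilde T h li lo m = H m (- m) by rewrite /htilde /cg_diag leNgt mn.
have -> : htilde T h li lo (- m) = H m m.
  rewrite /htilde /H !big_nat; apply: eq_bigr => lf /sym [_ e].
  by rewrite /cg_diag oppr_ge0 (ltW mn) e.
by rewrite addrC.
Qed.

Unset Implicit Arguments.

Theorem mainTheorem1 (R : realType) (L : nat)
    (T : forall li lf lo : nat,
       {bilinear 'Vec[R]_li -> 'Vec[R]_lf -> 'Vec[R]_lo})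
    (hT : forall li lf lo : nat,
       admissible li lf lo -> tensor_product_axiom (T li lf lo))
    (r : 'cV[R]_3) (hr : S2 r)
    (A : 'M[R]_3) (hA : SO3 A) (hAr : A *m r = pole R)
    (x : forall l : nat, 'Vec[R]_l)
    (h : nat -> nat -> nat -> R)
    (lo : nat) (hlo : (lo <= L)%N) :
  equiv_conv L T h x r lo =
  wigner lo (invmx A) *m
    \sum_(0 <= li < L.+1) so2_conv T h lo (wigner li A *m x li).
Proof.
(* It suffices to compare after applying D(R), which equivariance then moves into each factor,
   turning Y(r) into e_0. *)
suff e : wigner lo A *m equiv_conv L T h x r lo =
    \sum_(0 <= li < L.+1) so2_conv T h lo (wigner li A *m x li).
  by rewrite -e mulmxA wigner_invmx // mul1mx.
rewrite /equiv_conv mulmx_sumr; apply: eq_bigr => li _.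
rewrite so2_convE => [|lf]; last exact: hT.
rewrite mulmx_sumr !big_nat; apply: eq_bigr => lf hlf.
rewrite (hT li lf lo hlf).2 // -scalemxAr -wignerE // hAr sph_harm_pole //.
Qed.
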